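(* Let $\delta t>0$ and suppose that $\phi^{n-1},\phi^n,\phi^{n+1},\mu^{n+1}$ and the scalar $r^{n+1}$ satisfy the second-order scheme $$\frac{3\phi^{n+1}-4\phi^n+\phi^{n-1}}{2\delta t}=-\mathcal{G}\mu^{n+1},$$ $$\mu^{n+1}=\mathcal{L}\phi^{n+1}+\frac{r^{n+1}}{G\left(\int_{\Omega}F(\phi^{\dagger,n})\,dx\right)}F'(\phi^{\dagger,n}),$$ $$\frac{\int_{\Omega}\big(3F(\phi^{n+1})-4F(\phi^n)+F(\phi^{n-1})\big)dx}{2\delta t}=\frac{r^{n+1}}{G\left(\int_{\Omega}F(\phi^{\dagger,n})\,dx\right)}\left(F'(\phi^{\dagger,n}),\frac{3\phi^{n+1}-4\phi^n+\phi^{n-1}}{2\delta t}\right),$$ where $\phi^{\dagger,n}=2\phi^n-\phi^{n-1}$. Then the scheme is unconditionally energy stable, in the sense that (for every $\delta t>0$) $$\tilde E^{n+1}-\tilde E^{n}\le -\delta t\,(\mathcal{G}\mu^{n+1},\mu^{n+1}),$$ where $$\tilde E^k=\int_\Omega \frac14\Big(\mathcal{L}\phi^k\cdot\phi^k+\mathcal{L}(2\phi^k-\phi^{k-1})\cdot(2\phi^k-\phi^{k-1})\Big)dx+\frac32\int_{\Omega}F(\phi^k)\,dx-\frac12\int_{\Omega}F(\phi^{k-1})\,dx.$$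
   Context: $\Omega$ is a bounded spatial domain, $(\cdot,\cdot)$ is the $L^2(\Omega)$ inner product. $\mathcal{L}$ is a linear, self-adjoint, positive operator (so $(\mathcal{L}u,v)=(u,\mathcal{L}v)$ and $(\mathcal{L}u,u)\ge 0$); $\mathcal{G}$ is a positive operator ($(\mathcal{G}u,u)\ge 0$). $F$ is a nonlinear potential and $F'(\phi)$ its (variational) derivative. $G$ is an invertible scalar function (not to be confused with the operator $\mathcal{G}$). The unknowns $\phi^k,\mu^k$ are real-valued functions on $\Omega$, regular enough that all expressions make sense, satisfying either periodic boundary conditions or homogeneous Neumann conditions $\partial_{\mathbf n}\phi=\partial_{\mathbf n}\mu=0$ on $\partial\Omega$; it is understood that $G(\int_\Omega F(\phi^{\dagger,n})\,dx)$ is defined and nonzero. The scheme discretizes the gradient flow $\phi_t=-\mathcal{G}\mu$, $\mu=\mathcal{L}\phi+F'(\phi)$, whose free energy is $E(\phi)=\int_\Omega\frac12\mathcal{L}\phi\cdot\phi+F(\phi)\,dx$. *)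

(* Defs.v *)
From HB Require Import structures.
From mathcomp Require Import all_boot all_order all_algebra.
From mathcomp Require Import all_classical all_reals all_analysis.
Set Implicit Arguments.
Unset Strict Implicit.
Unset Printing Implicit Defensive.
Import Order.TTheory GRing.Theory Num.Theory.
Import numFieldNormedType.Exports.
Local Open Scope classical_set_scope.
Local Open Scope ring_scope.

(** ** Lebesgue measure on the Euclidean space of dimension [d.+1]

    The library has Lebesgue measure on [R] only.  Here it is the Caratheodory
    restriction of the outer measure
    [inf { \sum_k vol (Q_k) | A `<=` \bigcup_k Q_k, Q_k a half-open box }]. *)

Notation euclid R d := 'rV[R]_d.+1.

Definition half_open_box (R : realType) (d : nat) (a b : euclid R d) :
    set (euclid R d) :=
  [set x | forall i, a ord0 i <= x ord0 i < b ord0 i].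

(* The maximum makes the volume of an empty box (b i < a i) equal to 0. *)
Definition box_volume (R : realType) (d : nat) (a b : euclid R d) : R :=
  \prod_i Num.max (b ord0 i - a ord0 i) 0.

Definition box_cover (R : realType) (d : nat) (A : set (euclid R d)) :
    set (nat -> euclid R d * euclid R d) :=
  [set c | A `<=` \bigcup_k half_open_box (c k).1 (c k).2].

Definition leb (R : realType) (d : nat) (A : set (euclid R d)) : \bar R :=
  ereal_inf [set (\sum_(k <oo) (box_volume (c k).1 (c k).2)%:E)%E
            | c in box_cover A].

Section leb_outer_measure.
Local Open Scope ereal_scope.
Context (R : realType) (d : nat).
Implicit Types A B : set (euclid R d).

Let vol (q : euclid R d * euclid R d) : \bar R := (box_volume q.1 q.2)%:E.

Let vol_ge0 q : 0 <= vol q.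
Proof. by rewrite lee_fin; apply: prodr_ge0 => i _; rewrite le_max lexx orbT. Qed.

Lemma le_leb : {homo @leb R d : A B / A `<=` B >-> A <= B}.
Proof.
move=> A B AB; apply/ereal_inf_le_tmp => x [c Bc <-].
by exists c => //; exact: subset_trans Bc.
Qed.

Lemma leb_ge0 A : 0 <= leb A.
Proof.
apply: le_ereal_inf_tmp => x [c Ac <-].
by apply: nneseries_ge0 => n _ _; exact: (vol_ge0 (c n)).
Qed.

Lemma leb0 : leb (set0 : set (euclid R d)) = 0.
Proof.
apply/eqP; rewrite eq_le leb_ge0 andbT; apply: ereal_inf_lbound.
exists (fun=> (0%R, 0%R)) => //=.
apply: eseries0 => n _ _; rewrite /box_volume big_ord_recl /= !mxE subrr.
by rewrite maxxx mul0r.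
Qed.

Lemma leb_sigma_subadditive : sigma_subadditive (@leb R d).
Proof.
move=> A; have [[i ioo]|] := pselect (exists i, leb (A i) = +oo).
  rewrite (eseries_pinfty _ _ ioo) ?leey// => n _.
  by rewrite -ltNye (lt_le_trans _ (leb_ge0 _)).
rewrite -forallNE => Aoo.
suff add2e (e : {posnum R}) :
    leb (\bigcup_n A n) <= \sum_(i <oo) leb (A i) + e%:num%:E.
  by apply/lee_addgt0Pr => _/posnumP[].
rewrite (le_trans _ (epsilon_trick _ _ _))//; last first.
  by move=> n; exact: leb_ge0.
pose P n (c : nat -> euclid R d * euclid R d) := box_cover (A n) c /\
  \sum_(k <oo) vol (c k) <= leb (A n) + (e%:num / (2 ^ n.+1)%:R)%:E.
have [G PG] : {G : nat -> nat -> euclid R d * euclid R d & forall n, P n (G n)}.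
  apply: (@choice _ _ P) => n; rewrite /P /leb.
  set S := (X in ereal_inf X); move infS : (ereal_inf S) => iS.
  case: iS infS => [r Sr|Soo|Soo].
  - have en1 : (0 < e%:num / (2 ^ n.+1)%:R)%R by [].
    have /(lb_ereal_inf_adherent en1) : ereal_inf S \is a fin_num by rewrite Sr.
    move=> [x [c Ac <-] xS].
    by exists c; split => //; rewrite -Sr; exact/ltW.
  - by have := Aoo n; rewrite /leb Soo.
  - suff : lbound S 0 by move/le_ereal_inf_tmp; rewrite Soo.
    by move=> /= _ [c Ac <-]; apply: nneseries_ge0 => k _ _; exact: (vol_ge0 (c k)).
apply: (@le_trans _ _ (\esum_(i in setT) (vol \o uncurry G) i)).
  apply: ereal_inf_lbound => /=.
  have /card_esym/ppcard_eqP[f] := card_nat2.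
  exists (uncurry G \o f).
    move=> t [i _ Ait]; have [j _ Gij] := (PG i).1 _ Ait.
    by exists (f^-1%FUN (i, j)) => //=; rewrite invK ?inE.
  rewrite -(esum_pred_image (vol \o uncurry G) _ xpredT) ?[fun=> _]set_true//.
    by rewrite image_eq.
  by move=> n _; exact: vol_ge0.
rewrite (_ : esum _ _ = \sum_(i <oo) \sum_(j <oo ) vol (G i j)); last first.
  pose J : nat -> set (nat * nat) := fun i => [set (i, j) | j in setT].
  rewrite (_ : setT = \bigcup_k J k); last first.
    by rewrite predeqE => -[a b]; split => // _; exists a => //; exists b.
  rewrite esum_bigcupT /=; last 2 first.
    - apply/trivIsetP => i j _ _ ij.
      rewrite predeqE => -[n m] /=; split => //= -[] [_] _ [<-{n} _].
      by move=> [m' _] [] /esym/eqP; rewrite (negbTE ij).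
    - by move=> /= [n m]; exact: vol_ge0.
  rewrite -(image_id [set: nat]) -fun_true esum_pred_image//; last first.
    by move=> n _; apply: esum_ge0 => *; exact: vol_ge0.
  apply: eq_eseriesr => /= j _.
  rewrite -(esum_pred_image (vol \o uncurry G) (pair j) predT)//=; last first.
    by move=> ? ? _ _; exact: (@can_inj _ _ _ snd).
  by congr esum; rewrite predeqE => -[a b]; split; move=> [i _ <-]; exists i.
apply: lee_lim.
- apply: is_cvg_nneseries => n *.
  by apply: nneseries_ge0 => m *; exact: vol_ge0.
- by apply: is_cvg_nneseries => n *; apply: adde_ge0 => //; exact: leb_ge0.
- by near=> n; apply: lee_sum => i _; exact: (PG i).2.
Unshelve. all: by end_near. Qed.

HB.instance Definition _ := isOuterMeasure.Build R (euclid R d) (@leb R d)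
  leb0 leb_ge0 le_leb leb_sigma_subadditive.

End leb_outer_measure.

(* [euclid R d] with the sigma-algebra of Lebesgue measurable sets. *)
Notation lspace R d := (caratheodory_type (@leb R d)).

Definition lebesgue (R : realType) (d : nat) : set (lspace R d) -> \bar R :=
  @leb R d.

HB.instance Definition _ (R : realType) (d : nat) :=
  isMeasure.Build _ (lspace R d) R (@lebesgue R d)
    (@caratheodory_measure0 _ _ (@leb R d))
    (@caratheodory_measure_ge0 _ _ (@leb R d))
    (@caratheodory_measure_sigma_additive _ _ (@leb R d)).

(** ** Integrals, inner product and square-integrable functions

    Functions on [Omega] are total functions on the whole space; only their
    values on [Omega] (and on its closure, for boundary conditions) matter. *)

Definition integral_on (R : realType) (d : nat) (Omega : set (euclid R d))
    (f : euclid R d -> R) : R :=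
  \int[@lebesgue R d]_(x in Omega) f x.

Definition inner (R : realType) (d : nat) (Omega : set (euclid R d))
    (u v : euclid R d -> R) : R :=
  integral_on Omega (fun x => u x * v x).

Definition integrable_on (R : realType) (d : nat) (Omega : set (euclid R d))
    (f : euclid R d -> R) : Prop :=
  (@lebesgue R d).-integrable Omega (fun x : lspace R d => (f x)%:E).

Definition L2 (R : realType) (d : nat) (Omega : set (euclid R d))
    (u : euclid R d -> R) : Prop :=
  measurable_fun (Omega : set (lspace R d)) (u : lspace R d -> R) /\
  integrable_on Omega (fun x => u x ^+ 2).

Definition ae_eq_on (R : realType) (d : nat) (Omega : set (euclid R d))
    (f g : euclid R d -> R) : Prop :=
  \forall x \ae (@lebesgue R d), Omega x -> f x = g x.

(** ** Domains and boundary conditions *)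

Definition bounded_domain (R : realType) (d : nat) (Omega : set (euclid R d)) :
    Prop :=
  [/\ Omega !=set0, open Omega, connected Omega & bounded_set Omega].

Definition dotp (R : realType) (d : nat) (u v : euclid R d) : R :=
  \sum_i u ord0 i * v ord0 i.

(* Near [x], [Omega] is the sublevel set [rho < 0] of a C^1 function [rho] with
   [rho x = 0], and [nu] is the unit vector positively proportional to the
   (nonzero) gradient of [rho] at [x].  Boundary points where the boundary is
   not C^1, such as the corners of a polygon, have no outward normal. *)
Definition outward_unit_normal (R : realType) (d : nat)
    (Omega : set (euclid R d)) (x nu : euclid R d) : Prop :=
  dotp nu nu = 1 /\
  exists rho : euclid R d -> R,
    [/\ rho x = 0,
        \forall y \near x, differentiable rho y /\
          (forall v, {for y, continuous (fun z => 'D_v rho z)}),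
        \forall y \near x, Omega y <-> rho y < 0 &
        exists2 c : R, 0 < c & forall v, 'D_v rho x = c * dotp nu v].

(* The normal derivative is one-sided, taken from inside the domain. *)
Definition neumann (R : realType) (d : nat) (Omega : set (euclid R d))
    (u : euclid R d -> R) : Prop :=
  forall x nu, outward_unit_normal Omega x nu ->
    (u x - u (x - h *: nu)) / h @[h --> 0^'+] --> (0 : R).

(* [u] is on [Omega] the restriction of a continuous function on the whole
   space that has the periods [(b i - a i) e_i]. *)
Definition periodic (R : realType) (d : nat) (a b : euclid R d)
    (Omega : set (euclid R d)) (u : euclid R d -> R) : Prop :=
  exists v : euclid R d -> R,
    [/\ continuous v,
        forall i x, v (x + (b ord0 i - a ord0 i) *: delta_mx ord0 i) = v x &
        {in Omega, u =1 v}].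

Inductive boundary_condition (R : realType) (d : nat) :=
| Periodic of euclid R d & euclid R d
| Neumann.
Arguments Neumann {R d}.

(* Periodic conditions are posed on a box. *)
Definition bc_domain (R : realType) (d : nat) (bc : boundary_condition R d)
    (Omega : set (euclid R d)) : Prop :=
  match bc with
  | Periodic a b =>
      (forall i, a ord0 i < b ord0 i) /\
      Omega = [set x | forall i, a ord0 i < x ord0 i < b ord0 i]
  | Neumann => True
  end.

Definition satisfies_bc (R : realType) (d : nat) (bc : boundary_condition R d)
    (Omega : set (euclid R d)) (u : euclid R d -> R) : Prop :=
  match bc with
  | Periodic a b => periodic a b Omega u
  | Neumann => neumann Omega u
  end.

(** ** Operators and potential *)

Definition linear_subspace (R : realType) (d : nat)
    (V : set (euclid R d -> R)) : Prop :=
  V (fun=> 0) /\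
  forall (c : R) u v, V u -> V v -> V (fun x => c * u x + v x).

(* [calL], with domain [V], as an (in general unbounded) operator in
   L^2([Omega]); self-adjointness is symmetry on the domain. *)
Record linear_selfadjoint_positive (R : realType) (d : nat)
    (Omega : set (euclid R d)) (V : set (euclid R d -> R))
    (calL : (euclid R d -> R) -> (euclid R d -> R)) : Prop := {
  lsp_subspace : linear_subspace V;
  lsp_dom_L2 : forall u, V u -> L2 Omega u;
  lsp_L2 : forall u, V u -> L2 Omega (calL u);
  lsp_linear : forall (c : R) u v, V u -> V v ->
    ae_eq_on Omega (calL (fun x => c * u x + v x))
                   (fun x => c * calL u x + calL v x);
  lsp_selfadjoint : forall u v, V u -> V v ->
    inner Omega (calL u) v = inner Omega u (calL v);
  lsp_positive : forall u, V u -> 0 <= inner Omega (calL u) u }.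

(* [calG], with domain [W]; it is not assumed to be linear. *)
Record positive_operator (R : realType) (d : nat)
    (Omega : set (euclid R d)) (W : set (euclid R d -> R))
    (calG : (euclid R d -> R) -> (euclid R d -> R)) : Prop := {
  pos_dom_L2 : forall u, W u -> L2 Omega u;
  pos_L2 : forall u, W u -> L2 Omega (calG u);
  pos_positive : forall u, W u -> 0 <= inner Omega (calG u) u }.

(* [F phi] is the density of the nonlinear energy at the state [phi]: both a
   pointwise potential [f (phi x)] and one depending on derivatives of [phi]
   are of this form.  [F' phi] represents, in L^2([Omega]), the Gateaux
   derivative of [phi |-> \int_Omega F phi] in the directions of [V].  The set
   [D] of states at which [F] makes sense may be smaller than [V], as for a
   logarithmic potential. *)
Record potential_with_derivative (R : realType) (d : nat)
    (Omega : set (euclid R d)) (V D : set (euclid R d -> R))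
    (F F' : (euclid R d -> R) -> (euclid R d -> R)) : Prop := {
  pot_dom : D `<=` V;
  pot_integrable : forall phi, D phi -> integrable_on Omega (F phi);
  pot_L2 : forall phi, D phi -> L2 Omega (F' phi);
  pot_open : forall phi psi, D phi -> V psi ->
    \forall s \near (0 : R), D (fun x => phi x + s * psi x);
  pot_derivative : forall phi psi, D phi -> V psi ->
    is_derive (0 : R) (1 : R)
      (fun s : R => integral_on Omega (F (fun x => phi x + s * psi x)))
      (inner Omega (F' phi) psi) }.

(** ** The scheme *)

(* Both [2 phi^n - phi^{n-1}] and [2 phi^k - phi^{k-1}]. *)
Definition extrapolate (R : realType) (d : nat) (phi phi_prev : euclid R d -> R) :
    euclid R d -> R :=
  fun x => 2 * phi x - phi_prev x.

Definition bdf2 (R : realType) (d : nat) (dt : R)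
    (phi_next phi phi_prev : euclid R d -> R) : euclid R d -> R :=
  fun x => (3 * phi_next x - 4 * phi x + phi_prev x) / (2 * dt).

Definition modified_energy (R : realType) (d : nat) (Omega : set (euclid R d))
    (calL F : (euclid R d -> R) -> (euclid R d -> R))
    (phi phi_prev : euclid R d -> R) : R :=
  integral_on Omega (fun x =>
    4^-1 * (calL phi x * phi x +
            calL (extrapolate phi phi_prev) x * extrapolate phi phi_prev x))
  + 3 / 2 * integral_on Omega (F phi)
  - 1 / 2 * integral_on Omega (F phi_prev).

(* Main.v *)
(** Testing the first equation of the scheme with [mu^{n+1}] and substituting
    the second and third equations gives, with [s = phi^{n+1}], [q = phi^n] and
    [p = phi^{n-1}],
      [(L s, 3s - 4q + p) + \int (3 F(s) - 4 F(q) + F(p))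
         = - 2 dt (G mu^{n+1}, mu^{n+1})],
    and the identity
      [2 (L s, 3s - 4q + p) = (L s, s) + (L(2s-q), 2s-q) - (L q, q)
         - (L(2q-p), 2q-p) + (L(s-2q+p), s-2q+p)]
    turns the left-hand side into twice the energy increment plus a nonnegative
    term.  Splitting integrals requires the open set [Omega] to be
    Caratheodory measurable: a half-space is, since it cuts every box into two
    boxes whose volumes add up. *)

Require Import Defs.
From mathcomp Require Import all_boot all_order all_algebra.
From mathcomp Require Import all_classical all_reals all_analysis.
From mathcomp Require Import measurable_realfun ring lra.
Set Implicit Arguments.
Unset Strict Implicit.
Unset Printing Implicit Defensive.
Import Order.TTheory GRing.Theory Num.Theory.
Import numFieldNormedType.Exports.
Local Open Scope classical_set_scope.
Local Open Scope ring_scope.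

(** * Caratheodory measurability of open sets *)

Section open_measurable.
Context (R : realType) (d : nat).
Implicit Types (a b x : euclid R d) (i : 'I_d.+1) (c : R).

(** Applied with [Num.min] to the upper corner of a box, or with [Num.max] to the lower one, this
    cuts the box along the hyperplane [x_i = c]. *)
Definition clip (op : R -> R -> R) i c x : euclid R d :=
  \row_j if j == i then op (x ord0 j) c else x ord0 j.

(** Only the factor of index [i] changes. Truncation at 0 keeps the identity true when the box or
    one of its two pieces is empty. *)
Lemma box_volume_clip i c a b :
  box_volume a (clip Num.min i c b) + box_volume (clip Num.max i c a) b =
  box_volume a b.
Proof.
rewrite /box_volume (bigD1 i)//= [X in _ + X](bigD1 i)//= [RHS](bigD1 i)//=.
rewrite !mxE eqxx.
under eq_bigr => j /negPf ji do rewrite mxE ji.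
under [X in _ + _ * X]eq_bigr => j /negPf ji do rewrite mxE ji.
rewrite -mulrDl; congr (_ * _).
move: (a ord0 i) (b ord0 i) => u v; rewrite /Num.max /Num.min.
by do ! case: ifPn; rewrite -?leNgt; lra.
Qed.

Lemma box_volume_ge0 a b : 0 <= box_volume a b.
Proof. by apply: prodr_ge0 => i _; rewrite le_max lexx orbT. Qed.

(** Clipping a cover of [X] box by box yields covers of the two parts of [X], with the same total
    volume; the infimum over covers gives the Caratheodory inequality. *)
Lemma measurable_halfspace i c :
  measurable ([set x | x ord0 i < c] : set (lspace R d)).
Proof.
apply: le_caratheodory_measurable => X.
apply: le_ereal_inf_tmp => _ [q Xq <-].
rewrite (eq_eseriesr (g := fun k =>
    (box_volume (q k).1 (clip Num.min i c (q k).2))%:E +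
    (box_volume (clip Num.max i c (q k).1) (q k).2)%:E)%E); last first.
  by move=> k _; rewrite -EFinD box_volume_clip.
rewrite nneseriesD; [|by move=> *; rewrite lee_fin box_volume_ge0..].
apply: leeD; apply: ereal_inf_lbound.
- exists (fun k => ((q k).1, clip Num.min i c (q k).2)) => //.
  move=> x [/Xq[k _ qx] /= xc]; exists k => // j /=; rewrite mxE.
  have /andP[-> qx2] := qx j.
  by case: eqP => [ji|//]; rewrite lt_min qx2 ji xc.
- exists (fun k => (clip Num.max i c (q k).1, (q k).2)) => //.
  move=> x [/Xq[k _ qx] /negP /=]; rewrite -leNgt => cx.
  exists k => // j /=; rewrite mxE.
  have /andP[qx1 ->] := qx j; rewrite andbT.
  by case: eqP => [ji|//]; rewrite ge_max qx1 ji cx.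
Qed.

(** Strict half-spaces handle the upper ends, their complements the closed lower ends. *)
Lemma measurable_half_open_box a b :
  measurable (half_open_box a b : set (lspace R d)).
Proof.
rewrite (_ : half_open_box a b = \bigcap_(i in [set: 'I_d.+1])
    ([set x : euclid R d | x ord0 i < b ord0 i] `&`
     ~` [set x : euclid R d | x ord0 i < a ord0 i])); last first.
  apply/seteqP; split=> x abx i.
    by move=> _ /=; have /andP[ax xb] := abx i; split=> //; apply/negP; rewrite -leNgt.
  by have [/= xb /negP] := abx i I; rewrite -leNgt xb => ->.
apply: (@fin_bigcap_measurable _ (lspace R d)); first exact: finite_finset.
move=> i _; apply: measurableI; first exact: measurable_halfspace.
exact: measurableC (measurable_halfspace _ _).
Qed.

(** Rational corners make this a countable union. *)
Lemma open_bigcup_rat_box (U : set (euclid R d)) : open U ->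
  U = \bigcup_(q in [set q : 'rV[rat]_d.+1 * 'rV[rat]_d.+1 |
        half_open_box (map_mx ratr q.1) (map_mx ratr q.2) `<=` U])
      half_open_box (map_mx ratr q.1 : euclid R d) (map_mx ratr q.2).
Proof.
move=> oU; apply/seteqP; split => [x Ux|x [q qU]]; last exact: qU.
have /nbhs_ballP[e /= e0 xeU] : nbhs x U by exact: open_nbhs_nbhs.
(* Balls are those of the sup norm, so corners within [e / 2] of [x] in each coordinate keep the box
   inside the ball. *)
have /choice[l lP] i : exists q : rat, ratr q \in `]x ord0 i - e / 2, x ord0 i[.
  by apply: rat_in_itvoo; lra.
have /choice[r rP] i : exists q : rat, ratr q \in `]x ord0 i, x ord0 i + e / 2[.
  by apply: rat_in_itvoo; lra.
exists (\row_i l i, \row_i r i) => /=.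
  move=> y xy; apply: xeU; split=> // j i; rewrite !ord1.
  have := xy i; rewrite !mxE => /andP[ly yr].
  have := lP i; have := rP i; rewrite !in_itv/= => /andP[? ?] /andP[? ?].
  by rewrite /ball/= ltr_norml; apply/andP; split; lra.
move=> i; rewrite !mxE.
by have := lP i; have := rP i; rewrite !in_itv/= => /andP[? ?] /andP[? ?]; lra.
Qed.

Lemma open_measurable_lspace (U : set (euclid R d)) :
  open U -> measurable (U : set (lspace R d)).
Proof.
(* The union now runs over the whole countable type of pairs, boxes not contained in [U] being
   replaced by the empty set. *)
move=> /open_bigcup_rat_box ->; rewrite bigcup_mkcond.
apply: (@countable_bigcupT_measurable _ (lspace R d)) => [|q]; first exact: countableP.
by case: ifP => _; [exact: measurable_half_open_box|exact: measurable0].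
Qed.

End open_measurable.

(** * The inner product on square-integrable functions *)

Section inner_product.
Context (R : realType) (d : nat) (Omega : set (euclid R d)).
Hypothesis mOmega : measurable (Omega : set (lspace R d)).
Implicit Types (u v w f g : euclid R d -> R) (c : R).

Lemma integrable_onZ c f :
  integrable_on Omega f -> integrable_on Omega (fun x => c * f x).
Proof. exact: integrableZl. Qed.

Lemma integrable_onD f g : integrable_on Omega f -> integrable_on Omega g ->
  integrable_on Omega (fun x => f x + g x).
Proof. exact: integrableD. Qed.

Lemma integral_onZ c f : integrable_on Omega f ->
  integral_on Omega (fun x => c * f x) = c * integral_on Omega f.
Proof. exact: RintegralZl. Qed.

Lemma integral_onD f g : integrable_on Omega f -> integrable_on Omega g ->
  integral_on Omega (fun x => f x + g x) =
  integral_on Omega f + integral_on Omega g.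
Proof. exact: RintegralD. Qed.

(** The product is dominated by [u ^+ 2 + v ^+ 2]. *)
Lemma L2_integrableM u v : L2 Omega u -> L2 Omega v ->
  integrable_on Omega (fun x => u x * v x).
Proof.
move=> [mu u2] [mv v2].
apply: (le_integrable mOmega _ _ (integrable_onD u2 v2)).
  by apply/measurable_EFinP; exact: measurable_funM.
move=> x _; rewrite lee_fin (ger0_norm (addr_ge0 (sqr_ge0 _) (sqr_ge0 _))).
by rewrite ler_norml; apply/andP; split; nra.
Qed.

Lemma innerC u v : inner Omega u v = inner Omega v u.
Proof. by congr integral_on; apply/funext => x; rewrite mulrC. Qed.

Lemma innerDl c u v w : L2 Omega u -> L2 Omega v -> L2 Omega w ->
  inner Omega (fun x => c * u x + v x) w =
  c * inner Omega u w + inner Omega v w.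
Proof.
move=> u2 v2 w2; have uw := L2_integrableM u2 w2; have vw := L2_integrableM v2 w2.
rewrite /inner -integral_onZ// -integral_onD//; last exact: integrable_onZ.
by congr integral_on; apply/funext => x; rewrite mulrDl mulrA.
Qed.

Lemma innerNl u w : L2 Omega u -> L2 Omega w ->
  inner Omega (fun x => - u x) w = - inner Omega u w.
Proof.
move=> u2 w2; rewrite -mulN1r /inner -integral_onZ; last exact: L2_integrableM.
by congr integral_on; apply/funext => x; rewrite mulN1r mulNr.
Qed.

(** The scheme and the linearity of [calL] hold only almost everywhere; this lets them be tested
    against a function. *)
Lemma eq_innerl u v w :
  measurable_fun (Omega : set (lspace R d)) (u : lspace R d -> R) ->
  measurable_fun (Omega : set (lspace R d)) (v : lspace R d -> R) ->
  measurable_fun (Omega : set (lspace R d)) (w : lspace R d -> R) ->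
  ae_eq_on Omega u v -> inner Omega u w = inner Omega v w.
Proof.
move=> mu mv mw uv; congr fine; apply: ae_eq_integral => //.
- by apply/measurable_EFinP; exact: measurable_funM.
- by apply/measurable_EFinP; exact: measurable_funM.
- apply: (@filterS _ _ (ae_filter_ringOfSetsType (@lebesgue R d)) _ _ _ uv).
  by move=> x /= uvx Ox; rewrite uvx.
Qed.

End inner_product.

(** * The symmetric form defined by [calL] *)

Lemma linear_subspaceZ (R : realType) (d : nat) (V : set (euclid R d -> R))
    (c : R) (u : euclid R d -> R) :
  linear_subspace V -> V u -> V (fun x => c * u x).
Proof.
move=> [_ VD] Vu; rewrite (_ : (fun x => _) = fun x => (c - 1) * u x + u x).
  exact: VD.
by apply/funext => x; ring.
Qed.

(** The bracketing matches the shape [c * u x + v x] in which linearity is assumed. *)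
Definition comb3 (R : realType) (d : nat) (a b c : R) (u v w : euclid R d -> R) :
    euclid R d -> R :=
  fun x => a * u x + (b * v x + c * w x).

Section selfadjoint_positive_form.
Context (R : realType) (d : nat) (Omega : set (euclid R d)).
Context (V : set (euclid R d -> R)) (calL : (euclid R d -> R) -> (euclid R d -> R)).
Hypothesis mOmega : measurable (Omega : set (lspace R d)).
Hypothesis hL : linear_selfadjoint_positive Omega V calL.
Implicit Types (u v w z : euclid R d -> R) (a b c : R).

Let VS := lsp_subspace hL.
Let V2 := lsp_dom_L2 hL.
Let L2L := lsp_L2 hL.

Lemma comb3_dom a b c u v w : V u -> V v -> V w -> V (comb3 a b c u v w).
Proof.
by move=> Vu Vv Vw; apply: VS.2 => //; apply: VS.2 => //; exact: linear_subspaceZ.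
Qed.

Lemma calL_innerC u v : V u -> V v -> inner Omega (calL u) v = inner Omega (calL v) u.
Proof. by move=> Vu Vv; rewrite (lsp_selfadjoint hL)// innerC. Qed.

Lemma calL_innerDl c u v z : V u -> V v -> V z ->
  inner Omega (calL (fun x => c * u x + v x)) z =
  c * inner Omega (calL u) z + inner Omega (calL v) z.
Proof.
move=> Vu Vv Vz; rewrite -innerDl//; [|exact: L2L|exact: L2L|exact: V2].
apply: (eq_innerl mOmega); last exact: (lsp_linear hL).
- by apply: (L2L _).1; exact: VS.2.
- apply: measurable_funD; last exact: (L2L Vv).1.
  by apply: measurable_funM => //; exact: (L2L Vu).1.
- exact: (V2 Vz).1.
Qed.

Lemma calL_innerZl c u z : V u -> V z ->
  inner Omega (calL (fun x => c * u x)) z = c * inner Omega (calL u) z.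
Proof.
(* This splitting uses additivity directly, with no need for the value of [calL] at 0. *)
move=> Vu Vz; rewrite (_ : (fun x => _) = fun x => (c - 1) * u x + u x).
  by rewrite calL_innerDl//; ring.
by apply/funext => x; ring.
Qed.

Lemma calL_inner_comb3l a b c u v w z : V u -> V v -> V w -> V z ->
  inner Omega (calL (comb3 a b c u v w)) z =
  a * inner Omega (calL u) z + b * inner Omega (calL v) z +
  c * inner Omega (calL w) z.
Proof.
move=> Vu Vv Vw Vz; have Vcw : V (fun x => c * w x) by exact: linear_subspaceZ.
have Vbc : V (fun x => b * v x + c * w x) by exact: VS.2.
by rewrite calL_innerDl// calL_innerDl// calL_innerZl// addrA.
Qed.

(** On the span of three functions the form is determined by six numbers, so identities between its
    values become polynomial ones. *)
Lemma calL_inner_comb3 a b c a' b' c' u v w : V u -> V v -> V w ->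
  inner Omega (calL (comb3 a b c u v w)) (comb3 a' b' c' u v w) =
  a * a' * inner Omega (calL u) u + b * b' * inner Omega (calL v) v +
  c * c' * inner Omega (calL w) w +
  (a * b' + b * a') * inner Omega (calL u) v +
  (a * c' + c * a') * inner Omega (calL u) w +
  (b * c' + c * b') * inner Omega (calL v) w.
Proof.
move=> Vu Vv Vw; have V3 := comb3_dom a' b' c' Vu Vv Vw.
(* Symmetry moves the second combination into the first argument, where linearity expands it. *)
rewrite calL_inner_comb3l// !(calL_innerC _ V3)// !calL_inner_comb3l//.
rewrite (calL_innerC Vv Vu) (calL_innerC Vw Vu) (calL_innerC Vw Vv).
by ring.
Qed.

Lemma calL_bdf2_identity u v w : V u -> V v -> V w ->
  2 * inner Omega (calL u) (comb3 3 (- 4) 1 u v w) =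
  (inner Omega (calL u) u +
   inner Omega (calL (extrapolate u v)) (extrapolate u v)) -
  (inner Omega (calL v) v +
   inner Omega (calL (extrapolate v w)) (extrapolate v w)) +
  inner Omega (calL (comb3 1 (- 2) 1 u v w)) (comb3 1 (- 2) 1 u v w).
Proof.
move=> Vu Vv Vw.
(* Every function is written over the same triple, so that [calL_inner_comb3] expands each term. *)
have uE : u = comb3 1 0 0 u v w by apply/funext => x; rewrite /comb3; ring.
have uvE : extrapolate u v = comb3 2 (- 1) 0 u v w.
  by apply/funext => x; rewrite /comb3 /extrapolate; ring.
have vwE : extrapolate v w = comb3 0 2 (- 1) u v w.
  by apply/funext => x; rewrite /comb3 /extrapolate; ring.
rewrite uvE vwE [in LHS]uE.
(* Rewriting with [uE] also hit the [u] inside the second argument; it is folded back here. *)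
have -> : inner Omega (calL (comb3 1 0 0 u v w))
    (comb3 3 (- 4) 1 (comb3 1 0 0 u v w) v w) =
  inner Omega (calL (comb3 1 0 0 u v w)) (comb3 3 (- 4) 1 u v w).
  by rewrite -uE.
by rewrite !calL_inner_comb3//; ring.
Qed.

Lemma modified_energyE (F : (euclid R d -> R) -> (euclid R d -> R)) u v :
  V u -> V v ->
  modified_energy Omega calL F u v =
  4^-1 * (inner Omega (calL u) u +
          inner Omega (calL (extrapolate u v)) (extrapolate u v)) +
  3 / 2 * integral_on Omega (F u) - 1 / 2 * integral_on Omega (F v).
Proof.
move=> Vu Vv; have Ve : V (extrapolate u v).
  rewrite (_ : extrapolate u v = fun x => 2 * u x + (- 1) * v x).
    by apply: VS.2 => //; exact: linear_subspaceZ.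
  by apply/funext => x; rewrite /extrapolate; ring.
have iu := L2_integrableM mOmega (L2L Vu) (V2 Vu).
have ie := L2_integrableM mOmega (L2L Ve) (V2 Ve).
rewrite /modified_energy integral_onZ//; last exact: integrable_onD.
by rewrite integral_onD.
Qed.

End selfadjoint_positive_form.

(** * The energy estimate *)

Lemma integral_on_bdf2 (R : realType) (d : nat) (Omega : set (euclid R d))
    (f g h : euclid R d -> R) :
  measurable (Omega : set (lspace R d)) ->
  integrable_on Omega f -> integrable_on Omega g -> integrable_on Omega h ->
  integral_on Omega (fun x => 3 * f x - 4 * g x + h x) =
  3 * integral_on Omega f - 4 * integral_on Omega g + integral_on Omega h.
Proof.
move=> mO fi gi hi; rewrite (_ : (fun x => _) =
    fun x => 3 * f x + ((- 4) * g x + h x)); last by apply/funext => x; ring.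
have gi' := integrable_onZ mO (- 4) gi.
rewrite integral_onD//; [|exact: integrable_onZ|exact: integrable_onD].
by rewrite integral_onD// !integral_onZ//; ring.
Qed.

Theorem theorem5p1 (R : realType) (d : nat)
  (Omega : set (euclid R d)) (bc : boundary_condition R d)
  (V W D : set (euclid R d -> R))
  (calL calG F F' : (euclid R d -> R) -> (euclid R d -> R))
  (domG codG : set R) (G : R -> R)
  (dt : R) (phi_prev phi phi_next mu_next : euclid R d -> R) (r_next : R)
  (hOmega : bounded_domain Omega)
  (hbcOmega : bc_domain bc Omega)
  (hVbc : forall u, V u -> satisfies_bc bc Omega u)
  (hWbc : forall u, W u -> satisfies_bc bc Omega u)
  (hL : linear_selfadjoint_positive Omega V calL)
  (hcalG : positive_operator Omega W calG)
  (hF : potential_with_derivative Omega V D F F')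
  (hG : set_bij domG codG G)
  (hdt : 0 < dt)
  (hphi_prev : D phi_prev) (hphi : D phi) (hphi_next : D phi_next)
  (hphi_dag : D (extrapolate phi phi_prev))
  (hmu : W mu_next)
  (hdomG : domG (integral_on Omega (F (extrapolate phi phi_prev))))
  (hG_neq0 : G (integral_on Omega (F (extrapolate phi phi_prev))) <> 0)
  (scheme1 : ae_eq_on Omega (bdf2 dt phi_next phi phi_prev)
     (fun x => - calG mu_next x))
  (scheme2 : ae_eq_on Omega mu_next
     (fun x => calL phi_next x
        + r_next / G (integral_on Omega (F (extrapolate phi phi_prev)))
          * F' (extrapolate phi phi_prev) x))
  (scheme3 :
     integral_on Omega
       (fun x => 3 * F phi_next x - 4 * F phi x + F phi_prev x) / (2 * dt)
     = r_next / G (integral_on Omega (F (extrapolate phi phi_prev)))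
       * inner Omega (F' (extrapolate phi phi_prev))
           (bdf2 dt phi_next phi phi_prev)) :
  modified_energy Omega calL F phi_next phi
    - modified_energy Omega calL F phi phi_prev
  <= - dt * inner Omega (calG mu_next) mu_next.
Proof.
have mO : measurable (Omega : set (lspace R d)).
  by apply: open_measurable_lspace; case: hOmega.
have [Vp Vq Vs] : [/\ V phi_prev, V phi & V phi_next].
  by split; exact: (pot_dom hF).
set k := r_next / _ in scheme2 scheme3.
set fd := F' _ in scheme2 scheme3.
set b := bdf2 dt phi_next phi phi_prev in scheme1 scheme3.
have fd2 : L2 Omega fd by exact: (pot_L2 hF).
have Ls2 := lsp_L2 hL Vs.
have mu2 := pos_dom_L2 hcalG hmu.
have Gmu2 := pos_L2 hcalG hmu.
pose t := comb3 3 (- 4) 1 phi_next phi phi_prev.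
have Vt : V t by exact: (comb3_dom hL).
have bE : b = fun x => (2 * dt)^-1 * t x.
  by apply/funext => x; rewrite /b /bdf2 /t /comb3; ring.
have Vb : V b by rewrite bE; apply: linear_subspaceZ => //; exact: lsp_subspace hL.
have b2 := lsp_dom_L2 hL Vb.
(* The first equation is tested with [mu_next], the second below with the difference quotient
   [b]. *)
have Gmu_mu : inner Omega b mu_next = - inner Omega (calG mu_next) mu_next.
  rewrite -innerNl//; apply: (eq_innerl mO) => //; [exact: b2.1| |exact: mu2.1].
  by apply: measurableT_comp => //; exact: Gmu2.1.
have mu_b : inner Omega mu_next b =
    k * inner Omega fd b + inner Omega (calL phi_next) b.
  rewrite -innerDl//; apply: (eq_innerl mO); [exact: mu2.1| |exact: b2.1|].
    apply: measurable_funD; last exact: Ls2.1.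
    by apply: measurable_funM => //; exact: fd2.1.
  apply: (@filterS _ _ (ae_filter_ringOfSetsType (@lebesgue R d)) _ _ _ scheme2).
  by move=> x /= muE Ox; rewrite muE// addrC.
have L_b : inner Omega (calL phi_next) b =
    (2 * dt)^-1 * inner Omega (calL phi_next) t.
  by rewrite (calL_innerC hL)// bE (calL_innerZl mO hL)// (calL_innerC hL Vt).
have := calL_bdf2_identity mO hL Vs Vq Vp.
have := lsp_positive hL (comb3_dom hL 1 (- 2) 1 Vs Vq Vp).
have Fs := pot_integrable hF hphi_next.
have Fq := pot_integrable hF hphi.
have Fp := pot_integrable hF hphi_prev.
rewrite !(modified_energyE mO hL)// -/t.
move: scheme3; rewrite integral_on_bdf2//.
(* Comparing the two tests eliminates the nonlinear term from the third equation. *)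
have -> : k * inner Omega fd b =
  - inner Omega (calG mu_next) mu_next - (2 * dt)^-1 * inner Omega (calL phi_next) t.
  by rewrite -Gmu_mu -L_b (innerC _ b mu_next) mu_b; ring.
move=> /(congr1 ( *%R (2 * dt))).
have dt0 : 2 * dt != 0 by rewrite mulf_neq0 ?gt_eqF.
rewrite mulrC divfK// mulrBr mulVKf//.
(* The energy increment equals [- dt * inner Omega (calG mu_next) mu_next] minus a quarter of the
   nonnegative value of the form at [comb3 1 (- 2) 1]. *)
lra.
Qed.
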